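(* Let $\tau$ and $\tau'$ be two permutations of $\{1,\dots,m+1\}$, both without self-overlaps, such that $\tau(1)=\tau'(1)$ and $\tau(m+1)=\tau'(m+1)$. Then for all integers $n\ge0$ and $k\ge0$, the number of permutations of $\{1,\dots,n\}$ with exactly $k$ occurrences of $\tau$ equals the number of permutations of $\{1,\dots,n\}$ with exactly $k$ occurrences of $\tau'$. (That is, the number of permutations of length $n$ with $k$ occurrences of a non-self-overlapping pattern $\tau$ of length $m+1$ depends only on $n,k,m,\tau(1),\tau(m+1)$.)
   Context: For a word $s=s_1\dots s_j$ of distinct integers, $\mathrm{st}(s)$ is the permutation $\rho$ of $\{1,\dots,j\}$ with $s_i<s_l\iff\rho_i<\rho_l$. An occurrence of a pattern $\tau$ of length $j$ in a permutation $\sigma=\sigma_1\dots\sigma_n$ is an index $i$ with $\mathrm{st}(\sigma_i\dots\sigma_{i+j-1})=\tau$. A pattern $\tau$ of length $j$ has no self-overlaps if every permutation of length at most $2j-2$ has at most one occurrence of $\tau$. *)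

(* Defs.v *)
From mathcomp Require Import all_boot all_fingroup.

Set Implicit Arguments.
Unset Strict Implicit.
Unset Printing Implicit Defensive.

(* Positions and values are numbered from 0: 'S_n stands for the permutations
   of {0, ..., n-1}. Standardization and occurrences only depend on the
   relative order of the letters, so the shift by one is immaterial. *)

Definition perm_word (n : nat) (sigma : 'S_n) : seq nat :=
  [seq val (sigma i) | i <- enum 'I_n].

(* For a word s of distinct integers, [is_st s rho] says that rho = st(s);
   it includes the requirement that rho and s have the same length. *)
Definition is_st (j : nat) (s : seq nat) (rho : 'S_j) : bool :=
  (size s == j) &&
  [forall i : 'I_j, forall l : 'I_j,
     (nth 0 s i < nth 0 s l) == (rho i < rho l)].

(* The factor [take j (drop i _)] is shorter than j when i + j > n, in which
   case [is_st] is false. *)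
Definition occurrence (j n : nat) (tau : 'S_j) (sigma : 'S_n) (i : 'I_n) : bool :=
  is_st (take j (drop i (perm_word sigma))) tau.

Definition nb_occ (j n : nat) (tau : 'S_j) (sigma : 'S_n) : nat :=
  #|[set i : 'I_n | occurrence tau sigma i]|.

Definition no_self_overlaps (j : nat) (tau : 'S_j) : Prop :=
  forall n : nat, n <= 2 * j - 2 -> forall sigma : 'S_n, nb_occ tau sigma <= 1.

(* Main.v *)
Require Import Defs.
From mathcomp Require Import all_boot all_fingroup zify.

(** If tau occurs in sigma at every position of S, then any two of the
    corresponding windows meet in at most one letter, which is an endpoint of
    both.  As tau and tau' agree at both ends, the letters inside each window
    can be rearranged independently so as to read tau' there; this maps the
    permutations having tau at all positions of S injectively to those having
    tau' at all positions of S.  By symmetry the two numbers are equal for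
    every S, and inclusion-exclusion shows that the number of permutations
    whose occurrence set is exactly S is the same for tau and tau'. *)

Definition occ_set {j n : nat} (tau : 'S_j) (sigma : 'S_n) : {set 'I_n} :=
  [set i | occurrence tau sigma i].

Lemma nth_perm_word (n : nat) (sigma : 'S_n) (x : 'I_n) :
  nth 0 (perm_word sigma) x = sigma x.
Proof. by rewrite (nth_map x) ?size_enum_ord // nth_ord_enum. Qed.

Lemma size_perm_word (n : nat) (sigma : 'S_n) : size (perm_word sigma) = n.
Proof. by rewrite size_map size_enum_ord. Qed.

(** Tying [x] and [y] to offsets by equations in [nat] avoids carrying bound proofs for [i + p]. The
    inequality [i + j <= n] records that the factor is not truncated. *)
Lemma occurrenceP (j n : nat) (tau : 'S_j) (sigma : 'S_n) (i : 'I_n) :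
  reflect (i + j <= n /\
           forall (p q : 'I_j) (x y : 'I_n),
             x = i + p :> nat -> y = i + q :> nat ->
             (sigma x < sigma y) = (tau p < tau q))
          (occurrence tau sigma i).
Proof.
rewrite /occurrence /is_st.
have -> : (size (take j (drop i (perm_word sigma))) == j) = (i + j <= n).
  rewrite size_take_min size_drop size_perm_word.
  by have := ltn_ord i; lia.
have nthE (p : 'I_j) (x : 'I_n) : x = i + p :> nat ->
    nth 0 (take j (drop i (perm_word sigma))) p = sigma x.
  by move=> xE; rewrite nth_take // nth_drop -xE nth_perm_word.
apply: (iffP andP) => -[le_n H]; split=> //.
  move=> p q x y xE yE.
  by move/forallP/(_ p)/forallP/(_ q)/eqP: H; rewrite (nthE _ _ xE) (nthE _ _ yE).
apply/forallP=> p; apply/forallP=> q; apply/eqP.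
have px : i + p < n by have := ltn_ord p; lia.
have qx : i + q < n by have := ltn_ord q; lia.
rewrite (nthE p (Ordinal px)) // (nthE q (Ordinal qx)) //.
exact: H.
Qed.

(** The rank of [p], the number of [q] with [f q < f p], is strictly monotone in [f p] and less than
    [L]. *)
Lemma standardization (L : nat) (f : 'I_L -> nat) :
  injective f -> exists rho : 'S_L, forall p q, (rho p < rho q) = (f p < f q).
Proof.
move=> f_inj; pose below p := [set q | f q < f p].
have below_lt p : #|below p| < L.
  rewrite -[ltnRHS]card_ord -cardsT; apply: proper_card.
  by apply/properP; split; [exact: subsetT | exists p; rewrite !inE ?ltnn].
have below_mono p q : f p < f q -> #|below p| < #|below q|.
  move=> lt_pq; apply: proper_card; apply/properP; split.
    by apply/subsetP=> x; rewrite !inE => /ltn_trans; apply.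
  by exists p; rewrite !inE ?ltnn.
have rho_inj : injective (fun p => Ordinal (below_lt p)).
  move=> p q /(congr1 val) /= eq_pq; apply: f_inj.
  by case: (ltngtP (f p) (f q)) => // /below_mono; rewrite eq_pq ltnn.
exists (perm rho_inj) => p q; rewrite !permE /=.
case: (ltngtP (f p) (f q)) => [/below_mono //|/below_mono lt_qp|/f_inj ->].
  by apply/negbTE; rewrite -leqNgt ltnW.
by rewrite ltnn.
Qed.

(** Were [i' < i + m], the union of the two windows would have length [L <= 2 * m.+1 - 2], and its
    standardization would contain [tau] at both 0 and [i' - i]. *)
Lemma occurrences_spaced (m n : nat) (tau : 'S_m.+1) (sigma : 'S_n)
    (i i' : 'I_n) :
  no_self_overlaps tau -> occurrence tau sigma i -> occurrence tau sigma i' ->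
  i < i' -> i + m <= i'.
Proof.
move=> nso /occurrenceP[le_i Hi] /occurrenceP[le_i' Hi'] lt_ii'.
rewrite leqNgt; apply/negP=> lt_i'.
pose L := (i' - i) + m.+1.
have L_n (p : 'I_L) : i + p < n by have := ltn_ord p; rewrite /L; lia.
have f_inj : injective (fun p : 'I_L => val (sigma (Ordinal (L_n p)))).
  by move=> p q /val_inj/perm_inj/(congr1 val) /= /addnI/val_inj.
have [rho rhoE] := standardization _ _ f_inj.
have L0 : 0 < L by rewrite /L; lia.
have Ld : i' - i < L by rewrite /L; lia.
have L_le : L <= 2 * m.+1 - 2 by rewrite /L; lia.
have := nso L L_le rho; rewrite leqNgt => /negP; apply.
rewrite /nb_occ; apply/card_gt1P; exists (Ordinal L0), (Ordinal Ld); split.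
- rewrite inE; apply/occurrenceP; split=> /= [|p q x y xE yE].
    by rewrite /L; lia.
  by rewrite rhoE; apply: Hi => /=; lia.
- rewrite inE; apply/occurrenceP; split=> /= [|p q x y xE yE].
    by rewrite /L; lia.
  by rewrite rhoE; apply: Hi' => /=; lia.
- by rewrite -val_eqE /=; lia.
Qed.

Section Rearrangement.

Variables (m n : nat) (S : {set 'I_n}).
Hypothesis S_fits : forall i, i \in S -> i + m < n.
Hypothesis S_spaced : forall i i', i \in S -> i' \in S -> i < i' -> i + m <= i'.

(** [w] permutes the offsets inside each window; positions outside all windows stay fixed. [S_fits]
    rules out the default of [insubd]. *)
Definition rearrange (w : 'S_m.+1) (x : 'I_n) : 'I_n :=
  if [pick i in S | i <= x <= i + m] is Some i
  then insubd x (i + w (inord (x - i))) else x.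

(* A position lying in two windows is an endpoint of both, so the choice made
   by [pick] does not matter. *)
Lemma rearrangeE (w : 'S_m.+1) (i x : 'I_n) (p : 'I_m.+1) :
  w ord0 = ord0 -> w ord_max = ord_max -> i \in S -> x = i + p :> nat ->
  rearrange w x = i + w p :> nat.
Proof.
move=> w0 wm iS xE; rewrite /rearrange; have p_lt := ltn_ord p.
case: pickP => [i' /andP[i'S /andP[le_i' le_x]]|/(_ i)]; last first.
  by rewrite iS /=; lia.
have fits : i' + w (inord (x - i')) < n.
  by have := S_fits _ i'S; have := ltn_ord (w (inord (x - i'))); lia.
rewrite val_insubd fits.
case: (ltngtP i i') => [lt_ii'|lt_i'i|/val_inj eq_ii'].
(* Here [x] is the last position of window [i] and the first of window [i']; the next case is the
   mirror image. *)
- have le := S_spaced _ _ iS i'S lt_ii'.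
  have -> : p = ord_max by apply: val_inj => /=; lia.
  have -> : inord (x - i') = ord0 :> 'I_m.+1.
    by apply: val_inj; rewrite /= inordK; lia.
  by rewrite w0 wm /=; lia.
- have le := S_spaced _ _ i'S iS lt_i'i.
  have -> : p = ord0 by apply: val_inj => /=; lia.
  have -> : inord (x - i') = ord_max :> 'I_m.+1.
    by apply: val_inj; rewrite /= inordK; lia.
  by rewrite w0 wm /=; lia.
- have -> : inord (x - i') = p by apply: val_inj; rewrite /= inordK -?eq_ii'; lia.
  by rewrite eq_ii'.
Qed.

(** The image of [x] lies in the same window as [x], so there the inverse is computed offset by
    offset. *)
Lemma rearrangeK (w : 'S_m.+1) :
  w ord0 = ord0 -> w ord_max = ord_max ->
  cancel (rearrange w) (rearrange w^-1).
Proof.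
move=> w0 wm x.
have w0' : w^-1%g ord0 = ord0 by rewrite -[in LHS]w0 permK.
have wm' : w^-1%g ord_max = ord_max by rewrite -[in LHS]wm permK.
case: (pickP [pred i in S | i <= x <= i + m]) => [i /andP[iS /andP[ge_x le_x]]|H].
  have xE : x = i + (inord (x - i) : 'I_m.+1) :> nat by rewrite inordK; lia.
  apply: val_inj => /=.
  rewrite (rearrangeE _ _ _ _ w0' wm' iS (rearrangeE _ _ _ _ w0 wm iS xE)).
  by rewrite permK -xE.
have fixx w' : rearrange w' x = x.
  by rewrite /rearrange; case: pickP => // i; rewrite [X in is_true X]H.
by rewrite !fixx.
Qed.

End Rearrangement.

Lemma leq_card_occ_supset (m n : nat) (tau tau' : 'S_m.+1) (S : {set 'I_n}) :
  no_self_overlaps tau ->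
  tau ord0 = tau' ord0 -> tau ord_max = tau' ord_max ->
  #|[set sigma : 'S_n | S \subset occ_set tau sigma]| <=
  #|[set sigma : 'S_n | S \subset occ_set tau' sigma]|.
Proof.
move=> nso eq0 eqm.
set A := [set sigma | _]; case: (set_0Vmem A) => [->|[sigma0]]; first by rewrite cards0.
rewrite inE => /subsetP S_occ.
have S_fits i : i \in S -> i + m < n.
  by move/S_occ; rewrite inE => /occurrenceP[]; lia.
have S_spaced i i' : i \in S -> i' \in S -> i < i' -> i + m <= i'.
  move=> /S_occ; rewrite inE => Hi /S_occ; rewrite inE => Hi'.
  exact: occurrences_spaced nso Hi Hi'.
(* Reading [tau] at the offsets [w p] gives [tau']. Agreement of the patterns at both ends makes [w]
   fix both extreme offsets. *)
pose w : 'S_m.+1 := (tau' * tau^-1)%g.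
have wE p : tau (w p) = tau' p by rewrite permM permKV.
have w0 : w ord0 = ord0 by apply: (@perm_inj _ tau); rewrite wE.
have wm : w ord_max = ord_max by apply: (@perm_inj _ tau); rewrite wE.
have f_inj := can_inj (rearrangeK m n S S_fits S_spaced w w0 wm).
rewrite -(card_imset _ (mulgI (perm f_inj))); apply: subset_leq_card.
apply/subsetP=> _ /imsetP[sigma sigmaA ->]; rewrite inE in sigmaA.
rewrite inE; apply/subsetP=> i iS; rewrite inE.
have := subsetP sigmaA i iS; rewrite inE => /occurrenceP[le_i Hi].
apply/occurrenceP; split=> // p q x y xE yE.
rewrite !permM !permE -!wE; apply: Hi; exact: rearrangeE.
Qed.

Lemma card_supset_partition (T U : finType) (F : U -> {set T}) (S : {set T}) :
  #|[set u | S \subset F u]| =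
  \sum_(V : {set T} | S \subset V) #|[set u | F u == V]|.
Proof.
rewrite -sum1dep_card (partition_big F (fun V => S \subset V)) //=.
apply: eq_bigr => V sSV; rewrite -sum1dep_card; apply: eq_bigl => u.
by case: eqP => [->|]; rewrite ?sSV ?andbF.
Qed.

(** Downward induction from the full set: the terms of proper supersets of [S] agree and cancel from
    the two sums, leaving the term of [S]. *)
Lemma eq_card_supset (T U : finType) (F G : U -> {set T}) :
  (forall S : {set T}, #|[set u | S \subset F u]| = #|[set u | S \subset G u]|) ->
  forall S : {set T}, #|[set u | F u == S]| = #|[set u | G u == S]|.
Proof.
move=> eqFG S; have [N] := ubnP #|~: S|; elim: N S => // N IH S; rewrite ltnS => leN.
have := eqFG S; rewrite !card_supset_partition.
rewrite (bigD1 S) //= [RHS](bigD1 S) //=.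
rewrite (eq_bigr (fun V => #|[set u | G u == V]|)); first by move/addIn.
move=> V /andP[sSV neVS]; apply: IH; apply: leq_trans leN.
by apply: proper_card; rewrite properC properEneq eq_sym neVS.
Qed.

Theorem theorem4p10 (m : nat) (tau tau' : 'S_m.+1)
  (tau_nso : no_self_overlaps tau) (tau'_nso : no_self_overlaps tau')
  (eq_first : tau ord0 = tau' ord0) (eq_last : tau ord_max = tau' ord_max) :
  forall n k : nat,
    #|[set sigma : 'S_n | nb_occ tau sigma == k]| =
    #|[set sigma : 'S_n | nb_occ tau' sigma == k]|.
Proof.
move=> n k.
have eq_exact := @eq_card_supset _ _ (@occ_set _ n tau) (@occ_set _ n tau') _.
have count_by_set (rho : 'S_m.+1) :
    #|[set sigma : 'S_n | nb_occ rho sigma == k]| =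
    \sum_(S : {set 'I_n} | #|S| == k) #|[set sigma | occ_set rho sigma == S]|.
  rewrite -sum1dep_card.
  rewrite (partition_big (@occ_set _ n rho) (fun S => #|S| == k)) //=.
  apply: eq_bigr => S cS; rewrite -sum1dep_card; apply: eq_bigl => sigma.
  case: (occ_set rho sigma =P S) => [defS|_]; last by rewrite andbF.
  by rewrite andbT /nb_occ -/(occ_set rho sigma) defS cS.
rewrite !count_by_set; apply: eq_bigr => S _; apply: eq_exact => {}S.
(* The hypotheses are symmetric in [tau] and [tau'], so the injection exists in both directions. *)
by apply/eqP; rewrite eqn_leq !leq_card_occ_supset.
Qed.
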